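(* Let $n=\min(n_1,n_2)$, let $f:\mathbb{R}^n\to[0,\infty]$ be lower semicontinuous and absolutely symmetric, and let $F(X)=f(\sigma(X))$ for $X\in\mathbb{M}_{n_1,n_2}$. Let $P\subseteq\mathbb{R}^n$ be a set which is invariant under sign changes and permutations of coordinates. Let $X'=U_{X'}\Lambda_{x'}V_{X'}^*$ be a singular value decomposition of $X'\in\mathbb{M}_{n_1,n_2}$, where $x'=\sigma(X')$ is ordered non-increasingly. Fix $Z'\in\partial\mathcal{G}_F(X')$ and let $z'=\sigma(Z')$ be its non-increasing vector of singular values. Then $$\inf_{\substack{Y\in\mathbb{M}_{n_1,n_2},\ Y\ne X'\\ \sigma(Y)\in P}}\ \inf_{W\in\partial\mathcal{G}_F(Y)}\frac{\mathrm{Re}\,\langle W-Z',Y-X'\rangle}{\|Y-X'\|^2}=\inf_{\substack{y\in P\\ y\ne x'}}\ \inf_{w\in\partial\mathcal{G}_f(y)}\frac{\langle w-z',y-x'\rangle}{\|y-x'\|^2}.$$ Moreover, if one infimum is attained, then so is the other.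
   Context: $\mathbb{M}_{n_1,n_2}$ is the space of $n_1\times n_2$ matrices with real or complex entries, with the Frobenius inner product $\langle\cdot,\cdot\rangle$ and norm $\|\cdot\|$; $\mathbb{R}^n$ carries the Euclidean inner product and norm. $\sigma(X)\in\mathbb{R}^n$ is the vector of singular values of $X$ in non-increasing order. A singular value decomposition is $X=U\Lambda_{\sigma(X)}V^*$ with $U$ ($n_1\times n_1$) and $V$ ($n_2\times n_2$) unitary (orthogonal in the real case), where $\Lambda_\gamma$ denotes the (possibly non-square) diagonal matrix with $\gamma$ on the diagonal. A functional $f$ on $\mathbb{R}^n$ is absolutely symmetric if $f(x)=f(\Pi x)$ for all permutation matrices $\Pi$ and $f(x)=f((|x_1|,\dots,|x_n|))$ for all $x\in\mathbb{R}^n$. For a functional $g$ on an inner product space $\mathcal{V}$, set $\mathcal{S}_2(g)(Y)=\sup_{X\in\mathcal{V}}\big(-g(X)-\|X-Y\|^2\big)$, $\mathcal{Q}_2(g)=\mathcal{S}_2(\mathcal{S}_2(g))$ (the quadratic envelope), and $$\mathcal{G}_g(X)=\tfrac12\mathcal{Q}_2(g)(X)+\tfrac12\|X\|^2 .$$ For $g$ lower semicontinuous with values in $[0,\infty]$, $2\mathcal{G}_g$ is the lower semicontinuous convex envelope of $g(X)+\|X\|^2$. $\partial\mathcal{G}_g(X)$ denotes the subdifferential of convex analysis (with respect to $\mathrm{Re}\langle\cdot,\cdot\rangle$). $\mathcal{G}_f$ is formed on $\mathbb{R}^n$ and $\mathcal{G}_F$ on $\mathbb{M}_{n_1,n_2}$.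 Infima over empty sets are $+\infty$. *)

(* Defs.v *)
From HB Require Import structures.
From mathcomp Require Import all_boot all_order all_algebra.
From mathcomp Require Import perm.
From mathcomp.real_closed Require Import complex.
From mathcomp Require Import all_classical all_reals all_analysis.

Set Implicit Arguments.
Unset Strict Implicit.
Unset Printing Implicit Defensive.

Import Order.TTheory GRing.Theory Num.Theory.
Import numFieldNormedType.Exports.
Local Open Scope classical_set_scope.
Local Open Scope ring_scope.

(* Matrices have "real or complex entries": every notion below is parametrised
   by this choice, [scalarT R k] being literally [R] or [R[i]]. *)
Variant entries := RealEntries | ComplexEntries.

Definition scalarT (R : realType) (k : entries) : numFieldType :=
  match k with
  | RealEntries => R
  | ComplexEntries => R[i]
  end.

Definition of_real (R : realType) (k : entries) : R -> scalarT R k :=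
  match k return R -> scalarT R k with
  | RealEntries => fun x => x
  | ComplexEntries => fun x => real_complex R x
  end.

Definition re_part (R : realType) (k : entries) : scalarT R k -> R :=
  match k return scalarT R k -> R with
  | RealEntries => fun x => x
  | ComplexEntries => fun x => complex.Re x
  end.

Definition conj_scalar (R : realType) (k : entries) :
    scalarT R k -> scalarT R k :=
  match k return scalarT R k -> scalarT R k with
  | RealEntries => fun x => x
  | ComplexEntries => fun x => conjc x
  end.

Section QuadraticEnvelope.
(* [ip] is the real inner product of [V]: the Euclidean one on R^n, and
   Re <., .> on matrices. *)
Variables (R : realType) (V : zmodType) (ip : V -> V -> R).
Implicit Types (g : V -> \bar R) (X Y W Z : V).

Definition sqnorm X : R := ip X X.

Definition S2 g Y : \bar R :=
  ereal_sup [set (- g X - (sqnorm (X - Y))%:E)%E | X in [set: V]].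

Definition Q2 g : V -> \bar R := S2 (S2 g).

Definition Genv g X : \bar R :=
  ((2^-1)%:E * Q2 g X + (2^-1 * sqnorm X)%:E)%E.

(* As usual, the subdifferential is empty where [phi] is not finite. *)
Definition subdiff (phi : V -> \bar R) X : set V :=
  [set W | phi X \is a fin_num /\
           forall Y, (phi X + (ip W (Y - X))%:E <= phi Y)%E].

Definition quotient X Z Y W : R := ip (W - Z) (Y - X) / sqnorm (Y - X).

End QuadraticEnvelope.

Section Vectors.
Variables (R : realType) (n : nat).

Definition dotv (x y : 'cV[R]_n) : R := \sum_(i < n) x i 0 * y i 0.

Definition abs_symmetric (f : 'cV[R]_n -> \bar R) : Prop :=
  (forall (s : 'S_n) x, f x = f (perm_mx s *m x)) /\
  (forall x, f x = f (map_mx Num.norm x)).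

Definition signperm_invariant (P : set 'cV[R]_n) : Prop :=
  (forall (s : 'S_n) y, P y -> P (perm_mx s *m y)) /\
  (forall (e : 'I_n -> bool) y, P y -> P (\col_i ((-1) ^+ e i * y i 0))).

Definition nonincreasing_cV (x : 'cV[R]_n) : Prop :=
  forall i j : 'I_n, (i <= j)%N -> x j 0 <= x i 0.

End Vectors.

Section Matrices.
Variables (R : realType) (k : entries).
Local Notation K := (scalarT R k).

Definition adjoint (m n : nat) (A : 'M[K]_(m, n)) : 'M[K]_(n, m) :=
  (map_mx (@conj_scalar R k) A)^T.

Definition unitary_mx (n : nat) (U : 'M[K]_n) : Prop :=
  U *m adjoint U = 1%:M.

Definition frob (m n : nat) (A B : 'M[K]_(m, n)) : K :=
  \sum_(i < m) \sum_(j < n) A i j * conj_scalar (B i j).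

Definition re_frob (m n : nat) (A B : 'M[K]_(m, n)) : R :=
  re_part (frob A B).

Definition diag_rect (n1 n2 : nat) (x : 'cV[R]_(minn n1 n2)) :
    'M[K]_(n1, n2) :=
  \matrix_(i < n1, j < n2)
    \sum_(l < minn n1 n2 | (l == i :> nat) && (l == j :> nat))
      of_real k (x l 0).

Definition is_svd (n1 n2 : nat) (X : 'M[K]_(n1, n2)) (U : 'M[K]_n1)
    (x : 'cV[R]_(minn n1 n2)) (V : 'M[K]_n2) : Prop :=
  [/\ unitary_mx U, unitary_mx V & X = U *m diag_rect x *m adjoint V].

(* The non-increasing non-negative vector on the diagonal of a singular value
   decomposition of [X]; it always exists and is unique. *)
Definition sigma (n1 n2 : nat) (X : 'M[K]_(n1, n2)) : 'cV[R]_(minn n1 n2) :=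
  xget 0 [set x : 'cV[R]_(minn n1 n2) | [/\ forall i, 0 <= x i 0,
                        nonincreasing_cV x &
                        exists U V, is_svd X U x V]].

End Matrices.

(* Main.v *)
(* For a function [g] on vectors invariant under signed permutations,
   [G_(g o sigma) = G_g o sigma], and [W] is a subgradient of [g o sigma] at [Y]
   iff [Y] and [W] share a singular frame and [sigma W] is a subgradient of [g]
   at [sigma Y]; both facts come from von Neumann's trace inequality with its
   equality case.  Hence [X', Z'] share one frame and [Y, W] another.  With the
   singular values fixed, numerator and denominator of the quotient are affine
   in the overlap matrix of the two frames, which is doubly substochastic in
   absolute value; since linear functionals on such matrices are extremal at
   signed permutations (a signed Birkhoff theorem, proved here through linear
   programming duality), some signed permutation of [(sigma Y, sigma W)] has a
   quotient that is no larger.  Conversely, vectors are lifted to matrices along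
   the common frame of [X'] and [Z']. *)
Require Import Defs.
From HB Require Import structures.
From mathcomp Require Import all_boot all_order all_algebra.
From mathcomp Require Import perm.
From mathcomp.real_closed Require Import complex.
From mathcomp Require Import ring lra.
From mathcomp Require Import all_classical all_reals all_analysis.

Set Implicit Arguments.
Unset Strict Implicit.
Unset Printing Implicit Defensive.

Import Order.TTheory GRing.Theory Num.Theory.
Import numFieldNormedType.Exports.
Local Open Scope classical_set_scope.
Local Open Scope ring_scope.

(** * Real and complex scalars *)

Section Scalars.
Variables (R : realType) (k : entries).
Local Notation K := (scalarT R k).
Local Notation conj := (@conj_scalar R k).
Local Notation re := (@re_part R k).
Local Notation ofR := (@of_real R k).

Lemma conj_scalar_is_zmod_morphism : zmod_morphism conj.
Proof. by case: k => //= x y; rewrite rmorphB. Qed.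

Lemma conj_scalar_is_monoid_morphism : monoid_morphism conj.
Proof.
by split; case: k => //; [exact: rmorph1|exact: rmorphM].
Qed.

HB.instance Definition _ := GRing.isZmodMorphism.Build K K conj
  conj_scalar_is_zmod_morphism.
HB.instance Definition _ := GRing.isMonoidMorphism.Build K K conj
  conj_scalar_is_monoid_morphism.

Lemma of_real_is_zmod_morphism : zmod_morphism ofR.
Proof. by case: k => //= x y; rewrite rmorphB. Qed.

Lemma of_real_is_monoid_morphism : monoid_morphism ofR.
Proof.
by split; case: k => // x y; exact: rmorphM.
Qed.

HB.instance Definition _ := GRing.isZmodMorphism.Build R K ofR
  of_real_is_zmod_morphism.
HB.instance Definition _ := GRing.isMonoidMorphism.Build R K ofR
  of_real_is_monoid_morphism.

Lemma re_part_is_zmod_morphism : zmod_morphism re.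
Proof. by case: k => //= x y; rewrite raddfB. Qed.

HB.instance Definition _ := GRing.isZmodMorphism.Build K R re
  re_part_is_zmod_morphism.

Lemma conj_scalarK : involutive conj.
Proof. by case: k => //= x; rewrite conjcK. Qed.

Lemma conj_of_real r : conj (ofR r) = ofR r.
Proof. by case: k => //; exact: conjc_real. Qed.

Lemma re_of_real r : re (ofR r) = r.
Proof. by case: k. Qed.

Lemma re_conj z : re (conj z) = re z.
Proof. by case: k z => //= -[]. Qed.

Lemma re_ofRM r z : re (ofR r * z) = r * re z.
Proof. by case: k z => //= -[a b] /=; rewrite mul0r subr0. Qed.

Definition sqabs (z : K) : R := re (z * conj z).

Lemma mul_conj z : z * conj z = ofR (sqabs z).
Proof.
rewrite /sqabs; case: k z => //= -[a b] /=.
by apply/eqP; rewrite eq_complex /=; apply/andP; split; apply/eqP; ring.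
Qed.

Lemma sqabs_ge0 z : 0 <= sqabs z.
Proof.
rewrite /sqabs; case: k z => /= [z|[a b] /=]; first exact: sqr_ge0.
by rewrite mulrN opprK addr_ge0 // sqr_ge0.
Qed.

Lemma sqabs_eq0 z : (sqabs z == 0) = (z == 0).
Proof.
apply/eqP/eqP => [h|->]; last by rewrite /sqabs mul0r raddf0.
have /eqP := mul_conj z; rewrite h rmorph0 mulf_eq0 fmorph_eq0 orbb.
by move/eqP.
Qed.

Lemma sqabsD a b : sqabs (a + b) = sqabs a + sqabs b + 2 * re (a * conj b).
Proof.
rewrite /sqabs rmorphD mulrDl !mulrDr !raddfD /=.
rewrite -[re (b * conj a)]re_conj rmorphM /= conj_scalarK [conj b * a]mulrC.
by ring.
Qed.

(** Expand the nonnegative [sqabs (a + b)] and [sqabs (a - b)]. This is what will bound the entries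
    of an overlap of two frames. *)
Lemma re_mul_conj_le a b :
  `|re (a * conj b)| <= 2^-1 * (sqabs a + sqabs b).
Proof.
have := sqabs_ge0 (a + b); have := sqabs_ge0 (a + - b); rewrite !sqabsD.
have -> : sqabs (- b) = sqabs b by rewrite /sqabs rmorphN mulrNN.
rewrite rmorphN mulrN raddfN /= => h1 h2.
by rewrite ler_norml; apply/andP; split; lra.
Qed.

Lemma unit_phase z : exists2 c, c * conj c = 1 & conj (c * z) = c * z.
Proof.
have [->|nz] := eqVneq z 0.
  by exists 1; rewrite ?mulr0 ?rmorph0 // rmorph1 mulr1.
have s0 : 0 < sqabs z by rewrite lt_def sqabs_eq0 nz sqabs_ge0.
have r0 : Num.sqrt (sqabs z) != 0 by rewrite gt_eqF // sqrtr_gt0.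
exists (conj z * ofR (Num.sqrt (sqabs z))^-1).
  rewrite rmorphM /= conj_scalarK conj_of_real mulrACA [conj z * z]mulrC.
  rewrite mul_conj -!rmorphM -{1}(sqr_sqrtr (ltW s0)) -invfM -expr2.
  by rewrite divff ?rmorph1 // expf_neq0.
by rewrite mulrAC [conj z * z]mulrC mul_conj -rmorphM conj_of_real.
Qed.

End Scalars.

(** * Adjoints and unitary matrices over both scalar fields *)

Section Adjoint.
Variables (R : realType) (k : entries).
Local Notation K := (scalarT R k).
Local Notation conj := (@conj_scalar R k).
Local Notation re := (@re_part R k).
Local Notation ofR := (@of_real R k).

Lemma adjointE m n (A : 'M[K]_(m, n)) i j : adjoint A i j = conj (A j i).
Proof. by rewrite !mxE. Qed.

Lemma adjointM m n p (A : 'M[K]_(m, n)) (B : 'M[K]_(n, p)) :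
  adjoint (A *m B) = adjoint B *m adjoint A.
Proof. by rewrite /adjoint map_mxM trmx_mul. Qed.

Lemma adjointK m n (A : 'M[K]_(m, n)) : adjoint (adjoint A) = A.
Proof. by apply/matrixP=> i j; rewrite !mxE conj_scalarK. Qed.

Lemma adjointB m n (A B : 'M[K]_(m, n)) :
  adjoint (A - B) = adjoint A - adjoint B.
Proof. by rewrite /adjoint map_mxB linearB. Qed.

Lemma adjointZ m n c (A : 'M[K]_(m, n)) :
  adjoint (c *: A) = conj c *: adjoint A.
Proof. by rewrite /adjoint map_mxZ linearZ. Qed.

Lemma adjoint1 n : adjoint (1%:M : 'M[K]_n) = 1%:M.
Proof. by rewrite /adjoint map_mx1 trmx1. Qed.

Lemma unitary_adjoint n (U : 'M[K]_n) : unitary_mx U -> unitary_mx (adjoint U).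
Proof. by rewrite /unitary_mx adjointK => /mulmx1C. Qed.

Lemma adjoint_unitary_mul n (U : 'M[K]_n) :
  unitary_mx U -> adjoint U *m U = 1%:M.
Proof. exact: mulmx1C. Qed.

Lemma unitary_mul n (U V : 'M[K]_n) :
  unitary_mx U -> unitary_mx V -> unitary_mx (U *m V).
Proof.
by rewrite /unitary_mx adjointM mulmxA -(mulmxA U) => hU ->; rewrite mulmx1.
Qed.

Lemma unitaryK n m (U : 'M[K]_n) (A : 'M[K]_(n, m)) :
  unitary_mx U -> U *m (adjoint U *m A) = A.
Proof. by move=> hU; rewrite mulmxA hU mul1mx. Qed.

Lemma unitaryKV n m (U : 'M[K]_n) (A : 'M[K]_(n, m)) :
  unitary_mx U -> adjoint U *m (U *m A) = A.
Proof. by move/unitary_adjoint => hU; rewrite -{2}(adjointK U) unitaryK. Qed.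

Lemma mulmx_unitaryK n m (U : 'M[K]_n) (A : 'M[K]_(m, n)) :
  unitary_mx U -> A *m U *m adjoint U = A.
Proof. by move=> hU; rewrite -mulmxA hU mulmx1. Qed.

Lemma mulmx_unitaryKV n m (U : 'M[K]_n) (A : 'M[K]_(m, n)) :
  unitary_mx U -> A *m adjoint U *m U = A.
Proof.
by move/unitary_adjoint => hU; rewrite -{2}(adjointK U) mulmx_unitaryK.
Qed.

Lemma row_self_mul n (u : 'rV[K]_n) :
  u *m adjoint u = (ofR (\sum_j sqabs (u 0 j)))%:M.
Proof.
rewrite [LHS]mx11_scalar mxE (rmorph_sum ofR).
by under eq_bigr do rewrite adjointE mul_conj.
Qed.

Lemma row_self_mul_eq0 n (u : 'rV[K]_n) : (u *m adjoint u == 0) = (u == 0).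
Proof.
apply/eqP/eqP => [|->]; last by rewrite mul0mx.
rewrite row_self_mul => /matrixP/(_ 0 0); rewrite !mxE eqxx mulr1n => /eqP.
rewrite fmorph_eq0 psumr_eq0 => [/allP h|j _]; last exact: sqabs_ge0.
apply/rowP => j; rewrite mxE; apply/eqP.
by rewrite -sqabs_eq0; apply: h; rewrite mem_index_enum.
Qed.

End Adjoint.

(** * Existence of singular value decompositions *)

Section UnitVectors.
Variables (R : realType) (k : entries).
Local Notation K := (scalarT R k).
Local Notation conj := (@conj_scalar R k).
Local Notation ofR := (@of_real R k).

(** The scalar [u *m A *m adjoint u] is both [a] and [conj a] times the nonzero [u *m adjoint u]. *)
Lemma hermitian_eigenvalue_real n (A : 'M[K]_n) (u : 'rV[K]_n) a :
  adjoint A = A -> u != 0 -> u *m A = a *: u -> conj a = a.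
Proof.
move=> hA u0 uA.
have e1 : u *m A *m adjoint u = a *: (u *m adjoint u).
  by rewrite uA -scalemxAl.
have e2 : u *m A *m adjoint u = conj a *: (u *m adjoint u).
  by rewrite -mulmxA -{1}hA -adjointM uA adjointZ -scalemxAr.
have /eqP := e1; rewrite e2 -subr_eq0 -scalerBl scaler_eq0.
by rewrite row_self_mul_eq0 (negbTE u0) orbF subr_eq0 => /eqP.
Qed.

Lemma exists_unit_multiple n (u : 'rV[K]_n) : u != 0 ->
  exists2 c : R, 0 < c & (ofR c *: u) *m adjoint (ofR c *: u) = 1%:M.
Proof.
move=> u0; set N := \sum_j sqabs (u 0 j).
have N0 : 0 < N.
  rewrite lt_def sumr_ge0 ?andbT => [|j _]; last exact: sqabs_ge0.
  apply: contra u0 => /eqP NE.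
  by rewrite -row_self_mul_eq0 row_self_mul -/N NE rmorph0 raddf0.
exists (Num.sqrt N)^-1; first by rewrite invr_gt0 sqrtr_gt0.
rewrite adjointZ conj_of_real -scalemxAl -scalemxAr row_self_mul -/N.
rewrite !scale_scalar_mx -!rmorphM /= -{3}(sqr_sqrtr (ltW N0)).
by rewrite mulrA -expr2 -exprMn mulVf ?expr1n ?rmorph1 // gt_eqF ?sqrtr_gt0.
Qed.

(* Householder reflection, after a change of phase making [u 0 0] real. *)
Lemma unitary_with_first_row n (u : 'rV[K]_n.+1) : u *m adjoint u = 1%:M ->
  exists2 Q : 'M[K]_n.+1, unitary_mx Q & row 0 Q = u.
Proof.
have [c cc cu] := unit_phase (u 0 0) => uu.
pose u1 := c *: u.
have u1u1 : u1 *m adjoint u1 = 1%:M.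
  by rewrite adjointZ -scalemxAl -scalemxAr uu scalerA cc scale1r.
suff [H hH rH] : exists2 H : 'M[K]_n.+1, unitary_mx H & row 0 H = u1.
  exists (conj c *: H); last first.
    by rewrite linearZ /= rH scalerA mulrC cc scale1r.
  rewrite /unitary_mx adjointZ conj_scalarK -scalemxAl -scalemxAr hH scalerA.
  by rewrite mulrC cc scale1r.
have cu1 : conj (u1 0 0) = u1 0 0 by rewrite !mxE.
move: u1 u1u1 cu1 => {c cc cu} u1 u1u1 cu1.
pose e : 'rV[K]_n.+1 := delta_mx 0 0; pose w := e - u1.
have [w0|w_n0] := eqVneq w 0.
  exists 1%:M; first by rewrite /unitary_mx adjoint1 mulmx1.
  by rewrite rowE mulmx1; apply/eqP; rewrite -subr_eq0; apply/eqP.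
have ew : e *m adjoint w = (1 - u1 0 0)%:M.
  rewrite [LHS]mx11_scalar -rowE !mxE eqxx rmorphB rmorph1 /=.
  by rewrite cu1.
have ww : w *m adjoint w = ((1 - u1 0 0) *+ 2)%:M.
  rewrite {1}/w mulmxBl ew.
  have -> : u1 *m adjoint w = - (1 - u1 0 0)%:M.
    rewrite /w adjointB mulmxBr u1u1 /adjoint map_delta_mx trmx_delta -colE.
    rewrite [col 0 u1]mx11_scalar mxE.
    by rewrite [in RHS]raddfB opprB.
  by rewrite opprK -raddfD mulr2n.
have t0 : 1 - u1 0 0 != 0.
  by apply: contra w_n0 => /eqP t; rewrite -row_self_mul_eq0 ww t mul0rn raddf0.
have tc : conj (1 - u1 0 0) = 1 - u1 0 0.
  by rewrite rmorphB rmorph1 /= cu1.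
set t := 1 - _ in ew ww t0 tc.
(* As [w *m adjoint w] is twice [t], the factor [t^-1] is the Householder factor; [t] is real, so
   [H] is hermitian, and [e *m H = e - w = u1]. *)
pose H := 1%:M - t^-1 *: (adjoint w *m w).
have Hh : adjoint H = H.
  by rewrite /H adjointB adjoint1 adjointZ adjointM adjointK fmorphV /= tc.
exists H.
  have wwww : adjoint w *m w *m (adjoint w *m w) = (t *+ 2) *: (adjoint w *m w).
    rewrite mulmxA -(mulmxA _ w) ww.
    by rewrite mul_mx_scalar -scalemxAl.
  rewrite /unitary_mx Hh mulmxBl mul1mx mulmxBr mulmx1 -scalemxAl -scalemxAr.
  rewrite wwww !scalerA mulrnAr -mulrA mulVf // mulr1 mulr2n scalerDl.
  by rewrite opprB addrK subrK.
rewrite rowE mulmxBr mulmx1 -scalemxAr mulmxA ew mul_scalar_mx scalerA.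
by rewrite mulVf // scale1r /w subKr.
Qed.

End UnitVectors.

(** Over the complex numbers the characteristic polynomial has a root. A real symmetric matrix is
    complexified: the eigenvalue found is real, hence a root of the real characteristic
    polynomial. *)
Lemma hermitian_eigenvector (R : realType) (k : entries) n
    (A : 'M[scalarT R k]_n.+1) : adjoint A = A ->
  exists a, exists2 u : 'rV_n.+1, u != 0 & u *m A = a *: u.
Proof.
have complex_case (B : 'M[R[i]]_n.+1) : exists a, eigenvalue B a.
  have /closed_rootP[a ra] : size (char_poly B) != 1%N.
    by rewrite size_char_poly.
  by exists a; rewrite eigenvalue_root_char.
suff real_case : adjoint A = A -> exists a, eigenvalue A a.
  by move=> /real_case[a /eigenvalueP[u uA u0]]; exists a; exists u.
case: k A => A hA; last exact: complex_case.
pose B := map_mx (real_complex R) A.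
have [a aB] := complex_case B.
have hB : @adjoint R ComplexEntries _ _ B = B.
  apply/matrixP => i j; rewrite adjointE !mxE.
  move/matrixP/(_ i j): hA; rewrite !mxE => <-; exact: conjc_real.
have [u uB u0] := eigenvalueP aB.
have /= ca := hermitian_eigenvalue_real hB u0 uB.
exists (complex.Re a).
have aE : a = real_complex R (complex.Re a).
  by case: a ca {aB uB} => x y [] /eqP; rewrite eqNr => /eqP ->.
by move: aB; rewrite !eigenvalue_root_char -map_char_poly aE fmorph_root.
Qed.

Lemma nonzero_kernel_row (F : fieldType) m n (B : 'M[F]_(m, n)) :
  (\rank B < m)%N -> exists2 v : 'rV_m, v != 0 & v *m B = 0.
Proof.
move=> rB; have : kermx B != 0.
  by rewrite -mxrank_eq0 mxrank_ker subn_eq0 -ltnNge.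
by case/rowV0Pn => v /sub_kermxP vB v0; exists v.
Qed.

Section SVD.
Variables (R : realType) (k : entries).
Local Notation K := (scalarT R k).
Local Notation conj := (@conj_scalar R k).
Local Notation ofR := (@of_real R k).

(* [m <= n] matters only when the eigenvalue found is [0]: the rank deficiency
   of [X] then still provides a unit [v] in the kernel of [adjoint X]. *)
Lemma singular_pair m n (X : 'M[K]_(m.+1, n.+1)) : (m <= n)%N ->
  exists s (u : 'rV[K]_m.+1) (v : 'rV[K]_n.+1),
    [/\ 0 <= s, u *m adjoint u = 1%:M, v *m adjoint v = 1%:M,
        u *m X = ofR s *: v & v *m adjoint X = ofR s *: u].
Proof.
move=> mn.
have [|a [u0 u0n0 u0E]] := @hermitian_eigenvector R k m (X *m adjoint X).
  by rewrite adjointM adjointK.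
have [c c0 uu] := exists_unit_multiple u0n0; set u := _ *: u0 in uu.
have uE : u *m (X *m adjoint X) = a *: u.
  by rewrite -scalemxAl u0E !scalerA mulrC.
have [uX0|uXn0] := eqVneq (u *m X) 0.
  have [|v0 v0n0 v0E] := @nonzero_kernel_row K _ _ (adjoint X).
    rewrite mxrank_tr mxrank_map (leq_trans _ (mn : (m < n.+1)%N)) //.
    rewrite ltn_neqAle rank_leq_row andbT.
    apply/negP => fX; move/eqP: uX0; rewrite mulmx_free_eq0 // => /eqP uz.
    move: uu; rewrite uz mul0mx => /matrixP/(_ 0 0)/eqP.
    by rewrite !mxE eqxx eq_sym oner_eq0.
  have [d d0 vv] := exists_unit_multiple v0n0.
  exists 0, u, (ofR d *: v0); split; rewrite ?rmorph0 ?scale0r //.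
  by rewrite -scalemxAl v0E scaler0.
have [d d0 vv] := exists_unit_multiple uXn0; set v := _ *: _ in vv.
have dn0 : ofR d != 0 by rewrite fmorph_eq0 gt_eqF.
have uXE : u *m X = ofR d^-1 *: v by rewrite scalerA fmorphV mulVf // scale1r.
exists d^-1, u, v; split => //; first by rewrite invr_ge0 ltW.
have aE : a%:M = (ofR d^-1 * ofR d^-1)%:M :> 'M[K]_1.
  rewrite -[LHS]mulmx1 -uu mulmxA mul_scalar_mx -uE !mulmxA uXE.
  rewrite -mulmxA -adjointM uXE adjointZ conj_of_real -scalemxAl -scalemxAr.
  by rewrite scalerA vv scale_scalar_mx mulr1.
have {}aE : a = ofR d^-1 * ofR d^-1.
  by move/matrixP/(_ 0 0): aE; rewrite !mxE eqxx !mulr1n.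
by rewrite -scalemxAl -mulmxA uE scalerA aE mulrA fmorphV mulfV // mul1r.
Qed.

(** Induction by deflation: completing a singular pair to unitary matrices isolates one singular
    value in the corner and leaves a smaller block. Indexing [s] by [nat] lets it pass between
    dimensions without casts. *)
Lemma exists_diagonalization_le m n (X : 'M[K]_(m, n)) : (m <= n)%N ->
  exists (U : 'M[K]_m) (V : 'M[K]_n) (s : nat -> R),
  [/\ unitary_mx U, unitary_mx V, forall i, 0 <= s i &
      forall i j, (U *m X *m adjoint V) i j =
                  if i == j :> nat then ofR (s i) else 0].
Proof.
elim: m n X => [|m IH] [|n] // X mn.
- by exists 1%:M, 1%:M, (fun=> 0); split;
    rewrite /unitary_mx ?adjoint1 ?mulmx1 // => -[].
- by exists 1%:M, 1%:M, (fun=> 0); split;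
    rewrite /unitary_mx ?adjoint1 ?mulmx1 // => -[].
have [s [u [v [s0 uu vv uX vX]]]] := singular_pair X mn.
have [Q1 hQ1 rQ1] := unitary_with_first_row uu.
have [Q2 hQ2 rQ2] := unitary_with_first_row vv.
pose Y : 'M[K]_(1 + m, 1 + n) := Q1 *m X *m adjoint Q2.
have rowY : row 0 Y = ofR s *: delta_mx 0 0.
  rewrite /Y !row_mul rQ1 uX -scalemxAl -rQ2 -row_mul hQ2.
  by rewrite rowE mulmx1.
have colY : row 0 (adjoint Y) = ofR s *: delta_mx 0 0.
  rewrite /Y !adjointM adjointK !row_mul rQ2 mulmxA vX -scalemxAl -rQ1.
  by rewrite -row_mul hQ1 rowE mulmx1.
have YQ : Q1 *m X *m adjoint Q2 = Y by [].
clearbody Y.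
have [U [V [t [hU hV t0 tE]]]] := IH n (drsubmx Y) mn.
have block_adjoint p (W : 'M[K]_p) :
    adjoint (block_mx 1%:M 0 0 W : 'M[K]_(1 + p)) =
    block_mx 1%:M 0 0 (adjoint W).
  by rewrite /adjoint map_block_mx tr_block_mx !map_mx0 !trmx0 map_mx1 trmx1.
have block_unitary p (W : 'M[K]_p) : unitary_mx W ->
    unitary_mx (block_mx 1%:M 0 0 W : 'M[K]_(1 + p)).
  move=> hW; rewrite /unitary_mx block_adjoint mulmx_block !mul0mx !mulmx0.
  by rewrite !addr0 mul1mx add0r hW -scalar_mx_block.
pose U1 : 'M[K]_m.+1 := (block_mx 1%:M 0 0 U : 'M[K]_(1 + m)).
pose V1 : 'M[K]_n.+1 := (block_mx 1%:M 0 0 V : 'M[K]_(1 + n)).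
exists (U1 *m Q1), (V1 *m Q2), (fun i => if i is j.+1 then t j else s).
split; [exact: unitary_mul (block_unitary _ _ hU) hQ1
       |exact: unitary_mul (block_unitary _ _ hV) hQ2|by case|].
have -> : U1 *m Q1 *m X *m adjoint (V1 *m Q2) = U1 *m Y *m adjoint V1.
  by rewrite adjointM -YQ !mulmxA.
have Y0 j : Y ord0 j = if j == ord0 then ofR s else 0.
  move/rowP/(_ j): rowY; rewrite !mxE eqxx => ->.
  by case: eqP; rewrite ?mulr1 ?mulr0.
have Yr i : Y i ord0 = if i == ord0 then ofR s else 0.
  move/rowP/(_ i)/(congr1 conj): colY; rewrite !mxE conj_scalarK eqxx => ->.
  by case: eqP; rewrite ?mulr1 ?mulr0 ?rmorph0 ?conj_of_real.
have l0 p : lshift p (ord0 : 'I_1) = ord0 :> 'I_p.+1 by apply/ord_inj.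
have YE : Y = block_mx (ofR s)%:M 0 0 (drsubmx Y).
  rewrite -[LHS]submxK; congr block_mx; apply/matrixP => i j; rewrite !mxE.
  - by rewrite !ord1 !l0 Y0 eqxx.
  - by rewrite ord1 l0 Y0.
  - by rewrite ord1 l0 Yr.
have -> : U1 *m Y *m adjoint V1 =
    block_mx (ofR s)%:M 0 0 (U *m drsubmx Y *m adjoint V)
      :> 'M[K]_(1 + m, 1 + n).
  transitivity ((block_mx 1%:M 0 0 U : 'M[K]_(1 + m)) *m Y *m
    adjoint (block_mx 1%:M 0 0 V : 'M[K]_(1 + n))); first by [].
  rewrite block_adjoint YE !mulmx_block block_mxKdr.
  by rewrite !(mul0mx, mulmx0, mul1mx, mulmx1, addr0, add0r).
move=> i j; rewrite -(@splitK 1 m i) -(@splitK 1 n j).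
case: (@fintype.split 1 m i) => i'; case: (@fintype.split 1 n j) => j' /=.
- by apply: (etrans (block_mxEul _ _ _ _ _ _)); rewrite !ord1 mxE eqxx.
- by apply: (etrans (block_mxEur _ _ _ _ _ _)); rewrite mxE ord1.
- by apply: (etrans (block_mxEdl _ _ _ _ _ _)); rewrite mxE ord1.
- by apply: (etrans (block_mxEdr _ _ _ _ _ _)); rewrite tE.
Qed.

End SVD.

(** * The assignment problem *)

Section Assignment.
Variables (R : realType) (n : nat).
Implicit Types (E D N C M : 'I_n -> 'I_n -> R).

(* The list [x :: q] is a path read backwards, from its endpoint [x]; an edge
   from [y] to [x] gains [E y x - E y y], the effect of moving row [y] from its
   diagonal entry to column [x]. *)
Fixpoint path_gain E x (q : seq 'I_n) : R :=
  if q is y :: q' then E y x - E y y + path_gain E y q' else 0.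

Lemma path_gain_cat E x q1 y q2 :
  path_gain E x (q1 ++ y :: q2) =
  path_gain E x (rcons q1 y) + path_gain E y q2.
Proof.
elim: q1 x => [|z q1 IH] x /=; first by rewrite addr0.
by rewrite IH addrA.
Qed.

(** Closing the path by an edge from [x] back to its start [last x q] makes a cycle; a product of
    transpositions moves along it and fixes all other points. The last summand is the gain of the
    closing edge. *)
Lemma path_gain_perm E x q : uniq (x :: q) -> exists t : 'S_n,
  [/\ forall i, i \notin x :: q -> t i = i, t x = last x q &
      \sum_i E i (t i) = \sum_i E i i + path_gain E x q +
                         (E x (last x q) - E x x)].
Proof.
elim: q x => [|y q IH] x /=.
  move=> _; exists 1%g; split=> [i _||]; rewrite ?perm1 //.
  by rewrite subrr !addr0; apply: eq_bigr => i _; rewrite perm1.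
rewrite inE negb_or => /andP[/andP[xy xq] yq].
have [t [tout ty tsum]] := IH _ yq.
have tx : t x = x by apply: tout; rewrite inE negb_or xy.
exists (tperm x y * t)%g; split.
- move=> i; rewrite !inE !negb_or => /and3P[ix iy iq].
  by rewrite permM tpermD 1?eq_sym // tout // inE negb_or iy.
- by rewrite permM tpermL.
have yx : y != x by rewrite eq_sym.
move: tsum; rewrite (bigD1 x) //= (bigD1 y) //= [in X in _ -> X](bigD1 x) //=.
rewrite [in X in _ -> X](bigD1 y) //= !permM tpermL tpermR tx ty.
rewrite [in X in _ -> X](_ : \sum_(i | _) _ =
    \sum_(i | (i != x) && (i != y)) E i (t i)).
  by move=> H; lra.
apply: eq_bigr => i /andP[ix iy].
by rewrite permM tpermD // eq_sym.
Qed.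

(* [p i] is the largest gain of a simple path ending at [i]. *)
Lemma exists_potential E :
  (forall i j, 0 <= E i j) ->
  (forall t : 'S_n, \sum_i E i (t i) <= \sum_i E i i) ->
  exists p : 'I_n -> R, [/\ forall i, 0 <= p i, forall i, p i <= E i i &
    forall i j, E i j <= E i i + p j - p i].
Proof.
move=> E0 Emax.
(* A cycle of positive gain would improve on the identity, contrary to [Emax]. *)
have cycle_le0 x q : uniq (x :: q) ->
    path_gain E x q + (E x (last x q) - E x x) <= 0.
  by move=> /(path_gain_perm E)[t [_ _ tE]]; have := Emax t; rewrite tE; lra.
have best j : exists q, uniq (j :: q) /\
    forall q', uniq (j :: q') -> path_gain E j q' <= path_gain E j q.
  have u0 : uniq (j :: ([bseq] : n.-bseq 'I_n)) by [].
  (* Simple paths have bounded length, so the maximum can be taken over the finite type of bounded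
     sequences. *)
  have [q uq qmax] := @Order.TotalTheory.arg_maxP _ _ _ ([bseq] : n.-bseq 'I_n)
    (fun q : n.-bseq 'I_n => uniq (j :: q))
    (fun q : n.-bseq 'I_n => path_gain E j q) u0.
  exists q; split=> // q' uq'.
  have sq' : (size q' <= n)%N.
    have /andP[_ /card_uniqP <-] := uq'.
    by rewrite -[X in (_ <= X)%N]card_ord max_card.
  exact: (qmax (Bseq sq')).
have [q qP] := choice best.
exists (fun j => path_gain E j (q j)); split=> i.
- exact: (proj2 (qP i) [::]).
- by have := cycle_le0 i (q i) (proj1 (qP i)); have := E0 i (last i (q i)); lra.
move=> j; have [uqi _] := qP i; have [_ qj] := qP j.
suff : E i j - E i i + path_gain E i (q i) <= path_gain E j (q j) by lra.
have [jq|jnq] := boolP (j \in i :: q i); last first.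
  by apply: (qj (i :: q i)); rewrite cons_uniq jnq.
move: jq; rewrite inE => /predU1P[->|jq]; first by rewrite subrr add0r.
(* When [j] already lies on the best path to [i], the part from [j] to [i], closed by the edge from
   [i] to [j], is a cycle of nonpositive gain; the rest is a path ending at [j]. *)
case/splitPr: jq uqi => q1 q2; rewrite path_gain_cat => u.
have u1 : uniq (i :: rcons q1 j).
  by move: u; rewrite -cat_rcons -cat_cons cat_uniq => /and3P[].
have u2 : uniq (j :: q2).
  by move: u; rewrite -cat_cons cat_uniq => /and3P[].
have := cycle_le0 _ _ u1; have := qj _ u2; rewrite last_rcons; lra.
Qed.

(* Linear programming duality for the assignment problem: the potentials
   certify that a best permutation beats every doubly substochastic matrix. *)
Lemma assignment_bound D N :
  (forall i j, 0 <= D i j) -> (forall i j, 0 <= N i j) ->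
  (forall i, \sum_j N i j <= 1) -> (forall j, \sum_i N i j <= 1) ->
  exists s : 'S_n, \sum_i \sum_j D i j * N i j <= \sum_i D i (s i).
Proof.
move=> D0 N0 Nr Nc.
have [s _ smax] := @Order.TotalTheory.arg_maxP _ _ _ (1%g : 'S_n) xpredT
    (fun s : 'S_n => \sum_i D i (s i)) isT.
exists s.
(* Relabelling the columns by the optimal [s] makes the identity optimal, as the existence of
   potentials requires. *)
have [||p [p0 pD pE]] := @exists_potential (fun i j => D i (s j)) => //.
  move=> t; rewrite (eq_bigr (fun i => D i ((t * s)%g i))); first exact: smax.
  by move=> i _; rewrite permM.
(* Dual prices: [D i (s i) - p i] for row [i] and [p j] for column [s j]. They are nonnegative,
   dominate every entry of [D], and their total is the value of [s]. *)
have le1 i : \sum_j D i j * N i j <=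
    \sum_j (D i (s i) - p i) * N i j + \sum_j p j * N i (s j).
  rewrite (reindex_inj (@perm_inj _ s)) /=.
  rewrite [X in X + _](reindex_inj (@perm_inj _ s)) /= -big_split /=.
  apply: ler_sum => j _; rewrite -mulrDl ler_wpM2r //.
  by have := pE i j; lra.
apply: (le_trans (ler_sum _ (fun i _ => le1 i))); rewrite big_split /=.
have -> : \sum_i D i (s i) = \sum_i (D i (s i) - p i) + \sum_i p i.
  by rewrite -big_split; apply: eq_bigr => i _ /=; rewrite subrK.
apply: lerD.
  by apply: ler_sum => i _; rewrite -mulr_sumr ler_piMr // subr_ge0.
rewrite exchange_big /=; apply: ler_sum => j _.
by rewrite -mulr_sumr ler_piMr.
Qed.

(** Pass to absolute values: [e] marks the negative selected entries of [C], so that the right side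
    is a sum of moduli. *)
Lemma signed_assignment_bound C M :
  (forall i, \sum_j `|M i j| <= 1) -> (forall j, \sum_i `|M i j| <= 1) ->
  exists (s : 'S_n) (e : 'I_n -> bool),
    \sum_i \sum_j C i j * M i j <= \sum_i (-1) ^+ e i * C i (s i).
Proof.
move=> Mr Mc.
have [//|//|s sP] := @assignment_bound (fun i j => `|C i j|)
  (fun i j => `|M i j|) _ _ Mr Mc.
exists s, (fun i => C i (s i) < 0).
rewrite [leRHS](eq_bigr (fun i => `|C i (s i)|)) => [|i _]; last first.
  have [h|h] := ltrP (C i (s i)) 0.
    by rewrite expr1 mulN1r ltr0_norm.
  by rewrite expr0 mul1r ger0_norm.
apply: le_trans sP; apply: ler_sum => i _; apply: ler_sum => j _.
by rewrite -normrM ler_norm.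
Qed.

End Assignment.

(** * Rearrangement of nonincreasing sequences *)

Lemma rearrangement_nat (R : realType) n (a b : nat -> R) (s : 'S_n) :
  {homo a : i j / (i <= j)%N >-> j <= i} ->
  {homo b : i j / (i <= j)%N >-> j <= i} ->
  \sum_(i < n) a i * b (s i) <= \sum_(i < n) a i * b i.
Proof.
move=> ha hb.
(* [v] is the discrete integral of [a] against [b], a dual certificate *)
pose v j := \sum_(j <= k < n) a k * (b k - b k.+1).
have vE i j : (i <= j)%N -> (j <= n)%N ->
    v i - v j = \sum_(i <= k < j) a k * (b k - b k.+1).
  by move=> ij jn; rewrite /v (big_cat_nat ij jn) addrK.
have tel c i j : (i <= j)%N ->
    \sum_(i <= k < j) c * (b k - b k.+1) = c * (b i - b j).
  move=> ij; rewrite -mulr_sumr; congr (_ * _).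
  rewrite -opprB -telescope_sumr // -sumrN.
  by apply: eq_bigr => k _; rewrite opprB.
(* Between [i] and [j] the [a k] lie on one side of [a i], while [b k - b k.+1] is nonnegative.
   Summed over [i] with [j = s i], the values of [v] cancel because [s] is a bijection. *)
have key (i j : 'I_n) : a i * b j <= a i * b i - v i + v j.
  have [ij|/ltnW ji] := leqP i j.
    suff : v i - v j <= a i * (b i - b j) by lra.
    rewrite vE // 1?ltnW // -tel //; apply: ler_sum_nat => k /andP[ik _].
    by rewrite ler_wpM2r ?subr_ge0 ?hb ?ha.
  suff : a i * (b j - b i) <= v j - v i by lra.
  rewrite vE // 1?ltnW // -tel //; apply: ler_sum_nat => k /andP[_ /ltnW ki].
  by rewrite ler_wpM2r ?subr_ge0 ?hb ?ha.
apply: (le_trans (ler_sum _ (fun i _ => key i (s i)))).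
rewrite big_split sumrB /= [X in _ + X](_ : _ = \sum_(i < n) v i) ?subrK //.
by rewrite [RHS](reindex_inj (@perm_inj _ s)).
Qed.

(** * Signed permutations of vectors *)

Section SignedPermutations.
Variables (R : realType) (n : nat).
Implicit Types (x y z : 'cV[R]_n) (s : 'S_n) (e : 'I_n -> bool).

Definition signed_perm s e y : 'cV[R]_n := \col_i ((-1) ^+ e i * y (s i) 0).

Definition signed_perm_invariant T (g : 'cV[R]_n -> T) :=
  forall s e y, g (signed_perm s e y) = g y.

Lemma dotvC x y : dotv x y = dotv y x.
Proof. by apply: eq_bigr => i _; rewrite mulrC. Qed.

Lemma dotvDl x y z : dotv (x + y) z = dotv x z + dotv y z.
Proof. by rewrite -big_split; apply: eq_bigr => i _; rewrite mxE mulrDl. Qed.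

Lemma dotvNl x y : dotv (- x) y = - dotv x y.
Proof. by rewrite -sumrN; apply: eq_bigr => i _; rewrite mxE mulNr. Qed.

Lemma dotvBl x y z : dotv (x - y) z = dotv x z - dotv y z.
Proof. by rewrite dotvDl dotvNl. Qed.

Lemma dotvBr x y z : dotv x (y - z) = dotv x y - dotv x z.
Proof. by rewrite dotvC dotvBl !(dotvC x). Qed.

Lemma dotvDr x y z : dotv x (y + z) = dotv x y + dotv x z.
Proof. by rewrite dotvC dotvDl !(dotvC x). Qed.

Lemma dotv_ge0 x : 0 <= dotv x x.
Proof. by apply: sumr_ge0 => i _; rewrite -expr2 sqr_ge0. Qed.

Lemma dotv_eq0 x : dotv x x = 0 -> x = 0.
Proof.
move/eqP; rewrite psumr_eq0 => [/allP x0|i _]; last by rewrite -expr2 sqr_ge0.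
apply/colP => i; rewrite mxE; apply/eqP.
by rewrite -sqrf_eq0 expr2; apply: x0; rewrite mem_index_enum.
Qed.

Lemma signed_permB s e x y :
  signed_perm s e (x - y) = signed_perm s e x - signed_perm s e y.
Proof. by apply/colP => i; rewrite !mxE mulrBr. Qed.

Lemma dotv_signed_perm s e x y :
  dotv (signed_perm s e x) (signed_perm s e y) = dotv x y.
Proof.
rewrite [RHS](reindex_inj (@perm_inj _ s)); apply: eq_bigr => i _.
by rewrite !mxE mulrACA -expr2 sqrr_sign mul1r.
Qed.

Lemma signed_permK s e : exists s' e',
  cancel (signed_perm s e) (signed_perm s' e') /\
  cancel (signed_perm s' e') (signed_perm s e).
Proof.
exists s^-1%g, (fun i => e (s^-1%g i)); split=> y; apply/colP => i.
  by rewrite !mxE mulrA -expr2 sqrr_sign mul1r permKV.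
by rewrite !mxE mulrA permK -expr2 sqrr_sign mul1r.
Qed.

Lemma abs_symmetric_signed_perm (f : 'cV[R]_n -> \bar R) :
  abs_symmetric f -> signed_perm_invariant f.
Proof.
move=> [fperm fabs] s e y; rewrite fabs [RHS](fperm s) [RHS]fabs.
congr f; apply/colP => i; rewrite -row_permE !mxE.
by rewrite normrM normrX normrN1 expr1n mul1r.
Qed.

Lemma signperm_invariant_signed_perm (P : set 'cV[R]_n) s e y :
  signperm_invariant P -> P y -> P (signed_perm s e y).
Proof.
move=> [Pperm Psign] /(Pperm s)/(Psign e); rewrite -row_permE.
by congr P; apply/colP => i; rewrite !mxE.
Qed.

Lemma exists_sorted_signed_perm y : exists s e,
  (forall i, 0 <= signed_perm s e y i 0) /\
  nonincreasing_cV (signed_perm s e y).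
Proof.
pose t := [tuple `|y i 0| | i < n].
have st : size (sort >=%R t) == n by rewrite size_sort size_tuple.
have /tuple_permP[s sE] : perm_eq (Tuple st) t by rewrite /= perm_sort.
have yE i : signed_perm s (fun i => y (s i) 0 < 0) y i 0 = `|y (s i) 0|.
  rewrite mxE; have [h|h] := ltrP (y (s i) 0) 0.
    by rewrite expr1 mulN1r ltr0_norm.
  by rewrite expr0 mul1r ger0_norm.
exists s, (fun i => y (s i) 0 < 0); split=> [i|i j ij]; rewrite !yE //.
have nthE (l : 'I_n) : nth 0 (sort >=%R t) l = `|y (s l) 0|.
  by rewrite [sort _ _]sE -tnth_nth !tnth_mktuple.
rewrite -!nthE.
have tr : transitive (>=%R : rel R).
  by move=> a b c ba ac; exact: le_trans ac ba.
by apply: (sorted_leq_nth tr _ 0 _) ij; rewrite ?inE ?size_sort ?size_tuple //;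
  [exact: lexx | apply: sort_sorted => a b; exact: le_total].
Qed.

(** For nonnegative entries, dropping the signs can only increase the pairing; what remains is a
    rearrangement of ordered sequences. *)
Lemma rearrangement x y s e :
  (forall i, 0 <= x i 0) -> (forall i, 0 <= y i 0) ->
  nonincreasing_cV x -> nonincreasing_cV y ->
  dotv x (signed_perm s e y) <= dotv x y.
Proof.
move=> x0 y0 hx hy.
apply: (@le_trans _ _ (\sum_i x i 0 * y (s i) 0)).
  apply: ler_sum => i _; rewrite mxE ler_wpM2l //.
  rewrite (le_trans (ler_norm _)) // normrM normrX normrN1 expr1n mul1r.
  by rewrite ger0_norm.
case: n x y s e x0 y0 hx hy => [|m] x y s _ x0 y0 hx hy.
  by rewrite /dotv !big_ord0.
(* To obtain sequences on [nat], [ext] repeats the last entry forever, which preserves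
   monotonicity. *)
pose ext (z : 'cV[R]_m.+1) k := z (inord (minn k m)) 0.
have extE (z : 'cV[R]_m.+1) (i : 'I_m.+1) : ext z i = z i 0.
  rewrite /ext; congr (z _ _); apply: val_inj.
  by rewrite /= (minn_idPl (leq_ord i)) inordK.
have ext_homo (z : 'cV[R]_m.+1) : nonincreasing_cV z ->
    {homo ext z : i j / (i <= j)%N >-> j <= i}.
  move=> hz i j ij; apply: hz; rewrite !inordK ?ltnS ?geq_minr //.
  by rewrite leq_min geq_minr andbT (leq_trans (geq_minl _ _)).
have := rearrangement_nat s (ext_homo x hx) (ext_homo y hy).
rewrite /dotv; under eq_bigr do rewrite !extE.
by under [in X in _ <= X -> _]eq_bigr do rewrite !extE.
Qed.

End SignedPermutations.

(** * Envelope and subgradients under signed permutations *)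

Section VectorEnvelope.
Variables (R : realType) (n : nat).
Local Notation dot := (@dotv R n).

(** Signed permutations are isometries, so the supremum can be reindexed; one inequality is enough,
    since it applies to the inverse as well. *)
Lemma S2_signed_perm (g : 'cV[R]_n -> \bar R) :
  signed_perm_invariant g -> signed_perm_invariant (S2 dot g).
Proof.
move=> gI.
have S2_le s e y : (S2 dot g (signed_perm s e y) <= S2 dot g y)%E.
  apply: ge_ereal_sup => _ [x _ <-].
  have [s' [e' [_ K]]] := signed_permK R s e.
  apply: ereal_sup_ubound; exists (signed_perm s' e' x) => //.
  rewrite gI; congr (_ - _%:E)%E.
  by rewrite /sqnorm -{3 4}(K x) -signed_permB dotv_signed_perm.
move=> s e y; apply/le_anti; rewrite S2_le /=.
have [s' [e' [K _]]] := signed_permK R s e.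
by rewrite -{1}(K y) S2_le.
Qed.

Lemma Genv_signed_perm (g : 'cV[R]_n -> \bar R) :
  signed_perm_invariant g -> signed_perm_invariant (Genv dot g).
Proof.
move=> gI s e y; rewrite /Genv /Q2 /sqnorm dotv_signed_perm.
by rewrite !S2_signed_perm //; exact: S2_signed_perm.
Qed.

Lemma subdiff_signed_perm (g : 'cV[R]_n -> \bar R) s e y w :
  signed_perm_invariant g -> subdiff dot g y w ->
  subdiff dot g (signed_perm s e y) (signed_perm s e w).
Proof.
move=> gI [gfin gsub]; split=> [|x]; first by rewrite gI.
have [s' [e' [_ K]]] := signed_permK R s e.
rewrite -(K x) -signed_permB dotv_signed_perm !gI -(gI s' e' x); exact: gsub.
Qed.

End VectorEnvelope.

(** A permutation of the [minn n1 n2] diagonal positions has to act on all rows and on all columns;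
    the construction fixes the indices beyond [m]. *)
Lemma extend_perm m n (le_mn : (m <= n)%N) (s : 'S_m) :
  exists t : 'S_n, forall i, t (widen_ord le_mn i) = widen_ord le_mn (s i).
Proof.
pose h (s : 'S_m) (a : 'I_n) : 'I_n :=
  if insub (val a) is Some i then widen_ord le_mn (s i) else a.
have hw (r : 'S_m) i : h r (widen_ord le_mn i) = widen_ord le_mn (r i).
  by rewrite /h (valK i).
have hK : cancel (h s) (h s^-1%g).
  move=> a; case: (insubP 'I_m (val a)) => [i _ ia|am].
    have -> : a = widen_ord le_mn i by apply: val_inj; rewrite /= ia.
    by rewrite !hw permK.
  have ha (r : 'S_m) : h r a = a by rewrite /h insubN.
  by rewrite !ha.
exists (perm (can_inj hK)) => i; by rewrite permE hw.
Qed.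

(** * Overlap of singular frames *)

Section Frobenius.
Variables (R : realType) (k : entries).
Local Notation K := (scalarT R k).
Local Notation conj := (@conj_scalar R k).
Local Notation re := (@re_part R k).
Local Notation ofR := (@of_real R k).

Section Generic.
Variables m n : nat.
Implicit Types A B C : 'M[K]_(m, n).

Lemma re_frobE A B : re_frob A B = re (\tr (A *m adjoint B)).
Proof.
rewrite /re_frob /frob; congr re; apply: eq_bigr => i _; rewrite mxE.
by apply: eq_bigr => j _; rewrite adjointE.
Qed.

Lemma re_frobC A B : re_frob A B = re_frob B A.
Proof.
rewrite /re_frob -re_conj; congr re; rewrite /frob rmorph_sum.
apply: eq_bigr => i _; rewrite rmorph_sum; apply: eq_bigr => j _.
by rewrite rmorphM /= conj_scalarK mulrC.
Qed.

Lemma re_frobDl A B C : re_frob (A + B) C = re_frob A C + re_frob B C.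
Proof. by rewrite !re_frobE mulmxDl !raddfD. Qed.

Lemma re_frobBl A B C : re_frob (A - B) C = re_frob A C - re_frob B C.
Proof. by rewrite !re_frobE mulmxBl !raddfB. Qed.

Lemma re_frobBr A B C : re_frob A (B - C) = re_frob A B - re_frob A C.
Proof. by rewrite re_frobC re_frobBl !(re_frobC A). Qed.

Lemma re_frobDr A B C : re_frob A (B + C) = re_frob A B + re_frob A C.
Proof. by rewrite re_frobC re_frobDl !(re_frobC A). Qed.

Lemma re_frob_self A : re_frob A A = \sum_i \sum_j sqabs (A i j).
Proof.
by rewrite /re_frob raddf_sum; apply: eq_bigr => i _; rewrite raddf_sum.
Qed.

Lemma re_frob_ge0 A : 0 <= re_frob A A.
Proof.
by rewrite re_frob_self; do 2!apply: sumr_ge0 => ? _; exact: sqabs_ge0.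
Qed.

Lemma re_frob_eq0 A : re_frob A A = 0 -> A = 0.
Proof.
move/eqP; rewrite re_frob_self psumr_eq0 => [/allP A0|i _]; last first.
  by apply: sumr_ge0 => j _; exact: sqabs_ge0.
apply/matrixP => i j; rewrite mxE; apply/eqP; rewrite -sqabs_eq0.
have := A0 i (mem_index_enum _); rewrite psumr_eq0 => [/allP Ai|l _].
  by apply: Ai; rewrite mem_index_enum.
exact: sqabs_ge0.
Qed.

Lemma re_frob_unitary (U : 'M[K]_m) (V : 'M[K]_n) A B :
  unitary_mx U -> unitary_mx V ->
  re_frob (U *m A *m adjoint V) (U *m B *m adjoint V) = re_frob A B.
Proof.
move=> hU hV; rewrite !re_frobE !adjointM adjointK !mulmxA.
rewrite mulmx_unitaryKV // -2!mulmxA mxtrace_mulC !mulmxA.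
by rewrite mulmx_unitaryKV.
Qed.

Lemma unitary_sqabs_row p (U : 'M[K]_p) i :
  unitary_mx U -> \sum_j sqabs (U i j) = 1.
Proof.
move=> /matrixP/(_ i i)/(congr1 re).
rewrite !mxE eqxx mulr1n -(rmorph1 ofR) re_of_real raddf_sum => <-.
by apply: eq_bigr => j _; rewrite adjointE.
Qed.

Lemma unitary_sqabs_col p (U : 'M[K]_p) j :
  unitary_mx U -> \sum_i sqabs (U i j) = 1.
Proof.
move=> /unitary_adjoint/(unitary_sqabs_row j) <-; apply: eq_bigr => i _.
by rewrite adjointE /sqabs conj_scalarK mulrC.
Qed.

End Generic.

Variables n1 n2 : nat.
Local Notation n := (minn n1 n2).
Local Notation D := (@diag_rect R k n1 n2).
Local Notation wl := (widen_ord (geq_minl n1 n2)).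
Local Notation wr := (widen_ord (geq_minr n1 n2)).
Implicit Types (x y z w : 'cV[R]_n) (X Y Z W A B : 'M[K]_(n1, n2)).
Implicit Types (U : 'M[K]_n1) (V : 'M[K]_n2).

Lemma diag_rectE x : D x = \sum_l ofR (x l 0) *: delta_mx (wl l) (wr l).
Proof.
apply/matrixP => i j; rewrite summxE mxE big_mkcond; apply: eq_bigr => l _.
rewrite !mxE [i == _]eq_sym [j == _]eq_sym -!val_eqE /=.
by case: ifP; rewrite ?mulr1 ?mulr0.
Qed.

Lemma diag_rectB x y : D (x - y) = D x - D y.
Proof.
rewrite !diag_rectE -sumrB; apply: eq_bigr => l _.
by rewrite !mxE rmorphB scalerBl.
Qed.

Lemma diag_rectD x y : D (x + y) = D x + D y.
Proof.
rewrite !diag_rectE -big_split; apply: eq_bigr => l _.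
by rewrite !mxE rmorphD scalerDl.
Qed.

Lemma re_frob_diag A x : re_frob A (D x) = \sum_l x l 0 * re (A (wl l) (wr l)).
Proof.
rewrite re_frobC /re_frob /frob diag_rectE.
under eq_bigr => i _ do under eq_bigr => j _ do rewrite summxE big_distrl /=.
under eq_bigr => i _ do rewrite exchange_big /=.
rewrite exchange_big raddf_sum; apply: eq_bigr => l _.
rewrite (bigD1 (wl l)) //= (bigD1 (wr l)) //= !mxE !eqxx mulr1.
rewrite big1 ?addr0 => [|j jl]; last first.
  by rewrite !mxE (negbTE jl) andbF mulr0 mul0r.
rewrite big1 ?addr0 => [|i il]; last first.
  by apply: big1 => j _; rewrite !mxE (negbTE il) mulr0 mul0r.
by rewrite re_ofRM re_conj.
Qed.

Lemma re_frob_diag_diag x y : re_frob (D x) (D y) = dotv x y.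
Proof.
rewrite re_frob_diag; apply: eq_bigr => l _; rewrite mulrC mxE.
rewrite (big_pred1 l) ?re_of_real // => i /=.
by rewrite -val_eqE /= andbb.
Qed.

Lemma diag_rect_inj : injective D.
Proof.
move=> x y xy; apply/eqP; rewrite -subr_eq0; apply/eqP/dotv_eq0.
rewrite -re_frob_diag_diag diag_rectB xy subrr.
by rewrite re_frobE mul0mx mxtrace0 raddf0.
Qed.

(* Pairing two matrices with prescribed singular values is linear in the
   overlap of their singular frames, and the overlap matrix is doubly
   substochastic in absolute value. *)
Definition overlap U V (i j : 'I_n) : R :=
  re (U (wl i) (wl j) * conj (V (wr i) (wr j))).

Lemma re_frob_overlap U V x y :
  re_frob (U *m D x *m adjoint V) (D y) =
  \sum_i \sum_j y i 0 * x j 0 * overlap U V i j.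
Proof.
rewrite re_frob_diag; apply: eq_bigr => i _.
rewrite diag_rectE mulmx_sumr mulmx_suml summxE raddf_sum big_distrr.
apply: eq_bigr => j _ /=; rewrite -mulrA; congr (_ * _).
rewrite -scalemxAr -scalemxAl mxE re_ofRM; congr (_ * re _).
rewrite -(mul_delta_mx (0 : 'I_1)) mulmxA -colE -mulmxA -rowE.
by rewrite mxE big_ord1 !mxE.
Qed.

Lemma sum_widen_le m p (le_mp : (m <= p)%N) (F : 'I_p -> R) :
  (forall i, 0 <= F i) ->
  \sum_(i < m) F (widen_ord le_mp i) <= \sum_(i < p) F i.
Proof.
move=> F0; rewrite -(big_ord_narrow le_mp).
rewrite [leRHS](bigID (fun i : 'I_p => i < m)%N) /=.
by rewrite lerDl; apply: sumr_ge0.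
Qed.

(** Each entry is at most the mean of two squared moduli, and these sum to at most one along
    truncated rows of [U] and of [V]. *)
Lemma overlap_row U V i : unitary_mx U -> unitary_mx V ->
  \sum_j `|overlap U V i j| <= 1.
Proof.
move=> hU hV; apply: (le_trans (ler_sum _ (fun j _ => re_mul_conj_le _ _))).
rewrite -mulr_sumr big_split /= -[leRHS](mulVf (lt0r_neq0 (ltr0Sn R 1))).
rewrite ler_pM2l ?invr_gt0 ?ltr0Sn // -[leRHS]/(1 + 1) lerD //.
  rewrite -(unitary_sqabs_row (wl i) hU).
  by apply: sum_widen_le => j; exact: sqabs_ge0.
rewrite -(unitary_sqabs_row (wr i) hV).
by apply: (@sum_widen_le _ _ _ (fun j => sqabs (V (wr i) j))) => j;
  exact: sqabs_ge0.
Qed.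

Lemma overlap_col U V j : unitary_mx U -> unitary_mx V ->
  \sum_i `|overlap U V i j| <= 1.
Proof.
move=> hU hV; apply: (le_trans (ler_sum _ (fun j _ => re_mul_conj_le _ _))).
rewrite -mulr_sumr big_split /= -[leRHS](mulVf (lt0r_neq0 (ltr0Sn R 1))).
rewrite ler_pM2l ?invr_gt0 ?ltr0Sn // -[leRHS]/(1 + 1) lerD //.
  rewrite -(unitary_sqabs_col (wl j) hU).
  by apply: (@sum_widen_le _ _ _ (fun i => sqabs (U i (wl j)))) => i;
    exact: sqabs_ge0.
rewrite -(unitary_sqabs_col (wr j) hV).
by apply: (@sum_widen_le _ _ _ (fun i => sqabs (V i (wr j)))) => i;
  exact: sqabs_ge0.
Qed.

Lemma diag_rect_signed_perm s e : exists P Q, [/\ unitary_mx P, unitary_mx Q &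
  forall x, D (signed_perm s e x) = P *m D x *m adjoint Q].
Proof.
have [s1 s1E] := extend_perm (geq_minl n1 n2) s.
have [s2 s2E] := extend_perm (geq_minr n1 n2) s.
have perm_adj p (t : 'S_p) : adjoint (perm_mx t : 'M[K]_p) = perm_mx t^-1%g.
  by rewrite /adjoint map_perm_mx tr_perm_mx.
have perm_unitary p (t : 'S_p) : unitary_mx (perm_mx t : 'M[K]_p).
  by rewrite /unitary_mx perm_adj -perm_mxM mulgV perm_mx1.
(* All signs go into the left factor; rows beyond the diagonal get sign one by default. *)
pose sg (a : 'I_n1) : K :=
  (-1) ^+ (if insub (val a) is Some l then e l else false).
pose d := \row_a sg a.
have sgE l : sg (wl l) = (-1) ^+ e l by rewrite /sg (valK l).
have d_unitary : unitary_mx (diag_mx d).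
  apply/matrixP => i j; rewrite mul_diag_mx mxE adjointE !mxE.
  rewrite [j == i]eq_sym; case: eqP => [->|_]; rewrite ?rmorph0 ?mulr0 //.
  by rewrite mulr1n /sg rmorphXn rmorphN1 -expr2 sqrr_sign.
exists (diag_mx d *m perm_mx s1), (perm_mx s2); split=> [||x].
- exact: unitary_mul.
- exact: perm_unitary.
rewrite perm_adj -!mulmxA -col_permE -row_permE.
apply/matrixP => a b; rewrite mul_diag_mx !mxE.
rewrite [in RHS](reindex_inj (@perm_inj _ s)).
rewrite big_distrr /=; apply: eq_big => [l|l /andP[/eqP la _]].
  rewrite -[l == a :> nat]/(wl l == a) -[l == b :> nat]/(wr l == b).
  rewrite -(inj_eq (@perm_inj _ s1)) s1E -(inj_eq (@perm_inj _ s2)) s2E.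
  by rewrite -!val_eqE.
have -> : a = wl l by apply: val_inj.
by rewrite sgE mxE rmorphM rmorphXn rmorphN1.
Qed.

End Frobenius.

(** * Von Neumann's trace inequality and singular values *)

Section SingularValues.
Variables (R : realType) (k : entries) (n1 n2 : nat).
Local Notation K := (scalarT R k).
Local Notation n := (minn n1 n2).
Local Notation D := (@diag_rect R k n1 n2).
Local Notation ip := (@re_frob R k n1 n2).
Implicit Types (x y z w : 'cV[R]_n) (X Y Z W A B : 'M[K]_(n1, n2)).
Implicit Types (U : 'M[K]_n1) (V : 'M[K]_n2).

Lemma diag_rect_of_entries A (s : nat -> R) :
  (forall i j, A i j = if i == j :> nat then of_real k (s i) else 0) ->
  A = D (\col_(l < n) s l).
Proof.
move=> AE; apply/matrixP => i j; rewrite AE mxE.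
have [ij|ij] := eqVneq (i : nat) j; last first.
  rewrite big_pred0 // => l; apply/negP => /andP[/eqP li /eqP lj].
  by rewrite -li lj eqxx in ij.
have i_lt : (i < n)%N by rewrite leq_min ltn_ord ij ltn_ord.
rewrite (big_pred1 (Ordinal i_lt)) ?mxE // => l /=.
by rewrite -val_eqE /= -ij andbb.
Qed.

(** A matrix with more rows than columns is diagonalized through its adjoint. *)
Lemma exists_svd X : exists U x V, is_svd X U x V.
Proof.
have /orP[n12|n21] := leq_total n1 n2.
  have [U [V [s [hU hV _ /diag_rect_of_entries XE]]]] :=
    exists_diagonalization_le X n12.
  exists (adjoint U), (\col_l s l), (adjoint V).
  split; try exact: unitary_adjoint.
  by rewrite -XE adjointK -!mulmxA unitaryKV // adjoint_unitary_mul // mulmx1.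
have [U [V [s [hU hV _ XE]]]] := exists_diagonalization_le (adjoint X) n21.
exists (adjoint V), (\col_l s l), (adjoint U).
split; try exact: unitary_adjoint.
rewrite -(@diag_rect_of_entries (V *m X *m adjoint U)).
  by rewrite adjointK -!mulmxA unitaryKV // adjoint_unitary_mul // mulmx1.
move=> i j; have -> : V *m X *m adjoint U =
    adjoint (U *m adjoint X *m adjoint V).
  by rewrite !adjointM !adjointK mulmxA.
rewrite adjointE XE eq_sym; case: eqP => [->|_]; last by rewrite rmorph0.
by rewrite conj_of_real.
Qed.

Lemma svd_signed_perm X U x V (s : 'S_n) e : is_svd X U x V ->
  exists U' V', is_svd X U' (signed_perm s e x) V'.
Proof.
move=> [hU hV ->]; have [P [Q [hP hQ PQ]]] :=
  @diag_rect_signed_perm R k n1 n2 s e.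
exists (U *m adjoint P), (V *m adjoint Q).
split; try exact: unitary_mul _ (unitary_adjoint _).
rewrite PQ adjointM adjointK -!mulmxA unitaryKV //; congr (_ *m (_ *m _)).
by rewrite mulmxA adjoint_unitary_mul // mul1mx.
Qed.

Lemma re_frob_frames U1 V1 U2 V2 x y :
  unitary_mx U2 -> unitary_mx V2 ->
  ip (U1 *m D x *m adjoint V1) (U2 *m D y *m adjoint V2) =
  ip ((adjoint U2 *m U1) *m D x *m adjoint (adjoint V2 *m V1)) (D y).
Proof.
move=> hU hV.
rewrite -(re_frob_unitary _ _ (unitary_adjoint hU) (unitary_adjoint hV)).
rewrite adjointM !adjointK -!mulmxA unitaryKV //.
by rewrite adjoint_unitary_mul // mulmx1.
Qed.

Lemma re_frob_same_frame U V x y : unitary_mx U -> unitary_mx V ->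
  ip (U *m D x *m adjoint V) (U *m D y *m adjoint V) = dotv x y.
Proof. by move=> hU hV; rewrite re_frob_unitary // re_frob_diag_diag. Qed.

(** The pairing is linear in an overlap matrix, so the signed assignment bound applies. The
    diagonals may be unsorted and signed, which serves to lift subgradients along an arbitrary
    frame. *)
Lemma von_neumann X Y U1 V1 U2 V2 x y :
  is_svd X U1 x V1 -> is_svd Y U2 y V2 ->
  exists s e, ip X Y <= dotv y (signed_perm s e x).
Proof.
move=> [hU1 hV1 ->] [hU2 hV2 ->]; rewrite re_frob_frames // re_frob_overlap.
have hU := unitary_mul (unitary_adjoint hU2) hU1.
have hV := unitary_mul (unitary_adjoint hV2) hV1.
have [s [e le]] := signed_assignment_bound (fun i j => y i 0 * x j 0)
  (fun i => overlap_row i hU hV) (fun j => overlap_col j hU hV).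
exists s, e; apply: (le_trans le); rewrite le_eqVlt; apply/orP; left.
by apply/eqP; apply: eq_bigr => i _; rewrite mxE mulrCA.
Qed.

Lemma von_neumann_sorted X Y U1 V1 U2 V2 x y :
  is_svd X U1 x V1 -> is_svd Y U2 y V2 ->
  (forall i, 0 <= x i 0) -> (forall i, 0 <= y i 0) ->
  nonincreasing_cV x -> nonincreasing_cV y -> ip X Y <= dotv x y.
Proof.
move=> Xsvd Ysvd x0 y0 hx hy; have [s [e le]] := von_neumann Xsvd Ysvd.
by apply: (le_trans le); rewrite [leRHS]dotvC rearrangement.
Qed.

Lemma re_frob_svd X U x V : is_svd X U x V -> ip X X = dotv x x.
Proof. by move=> [hU hV ->]; rewrite re_frob_same_frame. Qed.

Lemma sigmaP X : [/\ forall i, 0 <= sigma X i 0, nonincreasing_cV (sigma X) &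
  exists U V, is_svd X U (sigma X) V].
Proof.
pose A := [set x : 'cV[R]_n | [/\ forall i, 0 <= x i 0, nonincreasing_cV x &
  exists U V, is_svd X U x V]].
suff : A (sigma X) by [].
apply: (@xgetPex _ 0 A).
have [U [x [V Xsvd]]] := exists_svd X.
have [s [e [x0 hx]]] := exists_sorted_signed_perm x.
by exists (signed_perm s e x); split=> //; exact: svd_signed_perm s e Xsvd.
Qed.

(** Von Neumann's inequality for [X] paired with itself, along two sorted decompositions, bounds
    [ip X X] by [dotv (sigma X) x]; both vectors have squared norm [ip X X], so they coincide. *)
Lemma sigma_unique X U x V : (forall i, 0 <= x i 0) -> nonincreasing_cV x ->
  is_svd X U x V -> sigma X = x.
Proof.
move=> x0 hx Xsvd; have [s0 hs [U' [V' Xsvd']]] := sigmaP X.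
apply/eqP; rewrite -subr_eq0; apply/eqP/dotv_eq0/le_anti.
rewrite dotv_ge0 andbT dotvBl !dotvBr (dotvC x).
rewrite -(re_frob_svd Xsvd) -(re_frob_svd Xsvd').
by have := von_neumann_sorted Xsvd' Xsvd s0 x0 hs hx; lra.
Qed.

Lemma sigma_svd X U x V : is_svd X U x V ->
  exists s e, sigma X = signed_perm s e x.
Proof.
move=> Xsvd; have [s [e [x0 hx]]] := exists_sorted_signed_perm x.
have [U' [V' Xsvd']] := svd_signed_perm s e Xsvd.
by exists s, e; exact: sigma_unique Xsvd'.
Qed.

Lemma signed_perm_invariant_sigma T (g : 'cV[R]_n -> T) X U x V :
  signed_perm_invariant g -> is_svd X U x V -> g (sigma X) = g x.
Proof. by move=> gI /sigma_svd[s [e ->]]; rewrite gI. Qed.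

Lemma re_frob_le_sigma X Y : ip X Y <= dotv (sigma X) (sigma Y).
Proof.
have [x0 hx [U1 [V1 Xsvd]]] := sigmaP X.
have [y0 hy [U2 [V2 Ysvd]]] := sigmaP Y.
exact: von_neumann_sorted Xsvd Ysvd x0 y0 hx hy.
Qed.

Lemma sqnorm_sigma X : dotv (sigma X) (sigma X) = ip X X.
Proof. by have [_ _ [U [V /re_frob_svd]]] := sigmaP X. Qed.

(* Equality case of von Neumann's inequality: a singular frame of [W + Y]
   diagonalizes both summands. *)
Lemma simultaneous_svd W Y : dotv (sigma W) (sigma Y) <= ip W Y ->
  exists U V, is_svd W U (sigma W) V /\ is_svd Y U (sigma Y) V.
Proof.
set w := sigma W; set y := sigma Y => wy.
have wyE : ip W Y = dotv w y.
  by apply/le_anti; rewrite wy re_frob_le_sigma.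
have [w0 hw _] := sigmaP W; have [y0 hy _] := sigmaP Y.
have [s0 hs [U [V SUV]]] := sigmaP (W + Y).
set s := sigma (W + Y) in s0 hs SUV.
have sqs : dotv s s = dotv (w + y) (w + y).
  rewrite -(re_frob_svd SUV) !re_frobDl !re_frobDr dotvDl !dotvDr.
  by rewrite !sqnorm_sigma (re_frobC Y W) (dotvC y w) wyE.
have sle : dotv s s <= dotv (w + y) s.
  rewrite -[leLHS](re_frob_svd SUV) re_frobDl dotvDl.
  by rewrite lerD ?re_frob_le_sigma.
(* The vectors [s] and [w + y] have equal norms, so [sle] makes the squared norm of their difference
   nonpositive. *)
have sE : s = w + y.
  apply/eqP; rewrite -subr_eq0; apply/eqP/dotv_eq0/le_anti.
  by rewrite dotv_ge0 andbT dotvBl !dotvBr (dotvC s (w + y)); lra.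
have [hU hV SE] := SUV.
pose Dw := U *m D w *m adjoint V; pose Dy := U *m D y *m adjoint V.
have DwDy : W + Y = Dw + Dy.
  by rewrite SE sE diag_rectD mulmxDr mulmxDl.
have Dwsvd : is_svd Dw U w V by [].
have Dysvd : is_svd Dy U y V by [].
have sDw : sigma Dw = w by apply: sigma_unique Dwsvd.
have sDy : sigma Dy = y by apply: sigma_unique Dysvd.
have e1 : ip W (Dw + Dy) = dotv w w + dotv w y.
  by rewrite -DwDy re_frobDr wyE sqnorm_sigma.
have l1 := re_frob_le_sigma W Dw; have l2 := re_frob_le_sigma W Dy.
(* The bounds [l1] and [l2] add up to the equality [e1], so [l1] is an equality and [W - Dw] has
   norm zero. *)
have WDw : W = Dw.
  apply/eqP; rewrite -subr_eq0; apply/eqP/re_frob_eq0/le_anti.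
  rewrite re_frob_ge0 andbT re_frobBl !re_frobBr (re_frobC Dw W).
  rewrite -!sqnorm_sigma; rewrite re_frobDr in e1.
  by rewrite sDw sDy -/w in l1 l2 *; lra.
exists U, V; split; first by rewrite [X in is_svd X]WDw.
by rewrite [X in is_svd X](_ : Y = Dy) //; apply: (addrI W); rewrite DwDy -WDw.
Qed.

End SingularValues.

(** * Envelopes and subdifferentials of spectral functions *)

Section MatrixEnvelope.
Variables (R : realType) (k : entries) (n1 n2 : nat).
Local Notation K := (scalarT R k).
Local Notation n := (minn n1 n2).
Local Notation D := (@diag_rect R k n1 n2).
Local Notation ip := (@re_frob R k n1 n2).
Local Notation dot := (@dotv R n).
Implicit Types (x y z w : 'cV[R]_n) (X Y Z W : 'M[K]_(n1, n2)).

Lemma svd_sub X Y U V x y : is_svd X U x V -> is_svd Y U y V ->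
  is_svd (X - Y) U (x - y) V.
Proof.
move=> [hU hV ->] [_ _ ->]; split=> //.
by rewrite diag_rectB mulmxBr mulmxBl.
Qed.

Lemma svd_dotv X Y U V x y : is_svd X U x V -> is_svd Y U y V ->
  ip X Y = dot x y.
Proof. by move=> [hU hV ->] [_ _ ->]; exact: re_frob_same_frame. Qed.

(** One bound holds because [sigma] does not increase distances, by von Neumann's inequality; the
    other lifts [x] along a frame of [Y], where distances are preserved. *)
Lemma S2_sigma (g : 'cV[R]_n -> \bar R) Y : signed_perm_invariant g ->
  S2 ip (fun X => g (sigma X)) Y = S2 dot g (sigma Y).
Proof.
move=> gI; apply/le_anti/andP; split.
  apply: ge_ereal_sup => _ [X _ <-]; apply: le_trans; last first.
    by apply: ereal_sup_ubound; exists (sigma X).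
  apply: leeB => //; rewrite lee_fin /sqnorm dotvBl !dotvBr.
  rewrite re_frobBl !re_frobBr !sqnorm_sigma (re_frobC Y) (dotvC (sigma Y)).
  by have := re_frob_le_sigma X Y; lra.
have [_ _ [U [V Ysvd]]] := sigmaP Y; have [hU hV _] := Ysvd.
apply: ge_ereal_sup => _ [x _ <-].
have Xsvd : is_svd (U *m D x *m adjoint V) U x V by [].
apply: ereal_sup_ubound; exists (U *m D x *m adjoint V) => //.
rewrite (signed_perm_invariant_sigma gI Xsvd) /sqnorm.
have XYsvd := svd_sub Xsvd Ysvd.
by rewrite (svd_dotv XYsvd XYsvd).
Qed.

Lemma Genv_sigma (g : 'cV[R]_n -> \bar R) : signed_perm_invariant g ->
  Genv ip (fun X => g (sigma X)) = fun X => Genv dot g (sigma X).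
Proof.
move=> gI; apply/funext => X; rewrite /Genv /Q2 /sqnorm -sqnorm_sigma.
have -> : S2 ip (fun X => g (sigma X)) = fun Y => S2 dot g (sigma Y).
  by apply/funext => Y; exact: S2_sigma.
by rewrite S2_sigma //; exact: S2_signed_perm.
Qed.

Lemma subdiff_sigma_svd (g : 'cV[R]_n -> \bar R) Y W :
  signed_perm_invariant g -> subdiff ip (fun X => g (sigma X)) Y W ->
  exists U V, [/\ is_svd Y U (sigma Y) V, is_svd W U (sigma W) V &
                  subdiff dot g (sigma Y) (sigma W)].
Proof.
move=> gI [gfin gsub].
(* Test the subgradient inequality at the matrix carrying [sigma Y] on a frame of [W]: the function
   has the same value there as at [Y], which forces equality in von Neumann's inequality. *)
have [|U [V [Wsvd Ysvd]]] := @simultaneous_svd _ _ _ _ W Y.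
  have [_ _ [U [V Wsvd]]] := sigmaP W; have [hU hV _] := Wsvd.
  have [y0 hy _] := sigmaP Y.
  have Xsvd : is_svd (U *m D (sigma Y) *m adjoint V) U (sigma Y) V by [].
  have := gsub (U *m D (sigma Y) *m adjoint V).
  rewrite (sigma_unique y0 hy Xsvd) -[leRHS]adde0 leeD2lE // lee_fin re_frobBr.
  by rewrite (svd_dotv Wsvd Xsvd) subr_le0.
exists U, V; split=> //; split=> // x; have [hU hV _] := Ysvd.
have Xsvd : is_svd (U *m D x *m adjoint V) U x V by [].
have := gsub (U *m D x *m adjoint V).
rewrite (signed_perm_invariant_sigma gI Xsvd).
by rewrite (svd_dotv Wsvd (svd_sub Xsvd Ysvd)).
Qed.

(** Von Neumann bounds [ip X W] by the pairing of [w] with a signed permutation of [sigma X]; [g] is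
    unchanged there, and the vector subgradient inequality applies. *)
Lemma subdiff_sigma (g : 'cV[R]_n -> \bar R) Y W U V y w :
  signed_perm_invariant g -> is_svd Y U y V -> is_svd W U w V ->
  subdiff dot g y w -> subdiff ip (fun X => g (sigma X)) Y W.
Proof.
move=> gI Ysvd Wsvd [gfin gsub]; rewrite /subdiff /=.
rewrite (signed_perm_invariant_sigma gI Ysvd); split=> // X.
have [_ _ [U' [V' Xsvd]]] := sigmaP X.
have [s [e le]] := von_neumann Xsvd Wsvd.
rewrite -(gI s e (sigma X)); apply: le_trans (gsub _).
rewrite leeD2l // lee_fin re_frobBr dotvBr (svd_dotv Wsvd Ysvd) lerD2r.
by rewrite re_frobC.
Qed.

End MatrixEnvelope.

(** * Comparison of the quotients *)

Section Quotients.
Variables (R : realType) (k : entries) (n1 n2 : nat).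
Local Notation K := (scalarT R k).
Local Notation n := (minn n1 n2).
Local Notation ip := (@re_frob R k n1 n2).
Local Notation dot := (@dotv R n).
Implicit Types (x y z w : 'cV[R]_n) (X Y Z W : 'M[K]_(n1, n2)).

Lemma quotient_svd X Z Y W U V x z y w :
  is_svd X U x V -> is_svd Z U z V -> is_svd Y U y V -> is_svd W U w V ->
  quotient ip X Z Y W = quotient dot x z y w.
Proof.
move=> Xsvd Zsvd Ysvd Wsvd; have YX := svd_sub Ysvd Xsvd.
by rewrite /quotient /sqnorm (svd_dotv (svd_sub Wsvd Zsvd) YX) (svd_dotv YX YX).
Qed.

Section TwoFrames.
Variables (X Z Y W : 'M[K]_(n1, n2)) (x z y w : 'cV[R]_n).
Variables (U1 U2 : 'M[K]_n1) (V1 V2 : 'M[K]_n2).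
Hypotheses (Xsvd : is_svd X U1 x V1) (Zsvd : is_svd Z U1 z V1).
Hypotheses (Ysvd : is_svd Y U2 y V2) (Wsvd : is_svd W U2 w V2).

Let num s e := dot (signed_perm s e w - z) (signed_perm s e y - x).
Let den s e := sqnorm dot (signed_perm s e y - x).

(* Any combination of numerator and denominator is affine in the overlap
   of the two frames, so some signed permutation bounds it from below. *)
Lemma signed_perm_le_frames a t : exists s e,
  a * num s e - t * den s e <= a * ip (W - Z) (Y - X) - t * sqnorm ip (Y - X).
Proof.
have [hU1 hV1 XE] := Xsvd; have [_ _ ZE] := Zsvd.
have [hU2 hV2 YE] := Ysvd; have [_ _ WE] := Wsvd.
pose M := overlap (adjoint U1 *m U2) (adjoint V1 *m V2).
have hU := unitary_mul (unitary_adjoint hU1) hU2.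
have hV := unitary_mul (unitary_adjoint hV1) hV2.
have cross A B u v : A = U2 *m diag_rect k u *m adjoint V2 ->
    B = U1 *m diag_rect k v *m adjoint V1 ->
    ip A B = \sum_i \sum_j v i 0 * u j 0 * M i j.
  by move=> -> ->; rewrite re_frob_frames // re_frob_overlap.
pose C i j := a * (x i 0 * w j 0 + z i 0 * y j 0) - 2 * t * (x i 0 * y j 0).
have [s [e]] := signed_assignment_bound C
  (fun i => overlap_row i hU hV) (fun j => overlap_col j hU hV).
have -> : \sum_i \sum_j C i j * M i j =
    a * (ip W X + ip Y Z) - 2 * t * ip Y X.
  rewrite (cross _ _ _ _ WE XE) (cross _ _ _ _ YE ZE) (cross _ _ _ _ YE XE).
  rewrite -big_split !mulr_sumr -sumrB; apply: eq_bigr => i _.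
  rewrite /= -big_split !mulr_sumr -sumrB; apply: eq_bigr => j _.
  by rewrite /C /=; ring.
have -> : \sum_i (-1) ^+ e i * C i (s i) =
    a * (dot x (signed_perm s e w) + dot z (signed_perm s e y))
    - 2 * t * dot x (signed_perm s e y).
  rewrite -big_split !mulr_sumr -sumrB; apply: eq_bigr => i _.
  by rewrite /C !mxE /=; ring.
move=> le; exists s, e; rewrite /num /den /sqnorm.
rewrite !re_frobBl !re_frobBr !dotvBl !dotvBr !dotv_signed_perm.
rewrite (svd_dotv Wsvd Ysvd) (svd_dotv Ysvd Ysvd) (svd_dotv Zsvd Xsvd).
rewrite (svd_dotv Xsvd Xsvd) (re_frobC Z Y) (re_frobC X Y).
rewrite (dotvC _ x) (dotvC (signed_perm s e y) x).
by move: le; lra.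
Qed.

Lemma quotient_signed_perm_le : Y <> X -> exists s e,
  signed_perm s e y <> x /\
  quotient dot x z (signed_perm s e y) (signed_perm s e w)
    <= quotient ip X Z Y W.
Proof.
move=> YX.
have den_gt0 s e : signed_perm s e y <> x -> 0 < den s e.
  move=> yx; rewrite lt_def dotv_ge0 andbT; apply/eqP => /dotv_eq0/eqP.
  by rewrite subr_eq0 => /eqP.
have Den_gt0 : 0 < sqnorm ip (Y - X).
  rewrite lt_def re_frob_ge0 andbT; apply/eqP => /re_frob_eq0/eqP.
  by rewrite subr_eq0 => /eqP.
(* Sign patterns become finite functions, so that the candidates form a finite type and a minimum
   exists. *)
pose sp (p : 'S_n * {ffun 'I_n -> bool}) := signed_perm p.1 p.2 y.
have spE s e : signed_perm s (finfun e) = signed_perm s e :> ('cV[R]_n -> _).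
  by apply/funext => v; apply/colP => i; rewrite !mxE ffunE.
(* With [a = 0] and [t = 1] the bound gives a signed permutation at least as far from [x] as [Y] is
   from [X], so the minimum is over a nonempty set. *)
have [s0 [e0 le0]] := signed_perm_le_frames 0 1.
have p0 : sp (s0, finfun e0) != x.
  rewrite /sp /= spE; apply/eqP => yx.
  have : den s0 e0 = 0.
    rewrite /den /sqnorm yx subrr.
    by apply: big1 => i _; rewrite !mxE mul0r.
  by move=> d0; move: le0; rewrite d0; lra.
pose q (p : 'S_n * {ffun 'I_n -> bool}) := num p.1 p.2 / den p.1 p.2.
have [[s e] /= /eqP se_x qmin] :=
  @Order.TotalTheory.arg_minP _ _ _ (s0, finfun e0) (fun p => sp p != x) q p0.
exists s, e; split=> //; rewrite -/(num s e) -/(den s e).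
have [s1 [e1 le1]] := signed_perm_le_frames 1 (q (s, e)).
rewrite /quotient -/(num s e) ler_pdivlMr //.
suff : 0 <= num s1 e1 - q (s, e) * den s1 e1.
  by move: le1; rewrite !mul1r /q /=; lra.
(* If the selected vector is [x] itself, numerator and denominator both vanish. *)
have [yx|yx] := pselect (signed_perm s1 e1 y = x).
  rewrite /num /den /sqnorm yx subrr.
  have dot0 v : dot v 0 = 0 by apply: big1 => i _; rewrite mxE mulr0.
  by rewrite !dot0 mulr0 subrr.
rewrite subr_ge0 -ler_pdivlMr ?den_gt0 //.
have := qmin (s1, finfun e1); rewrite /q /num /den /sp /= !spE; apply.
exact/eqP.
Qed.

End TwoFrames.

End Quotients.

(** * Equality of the two infima and transfer of attainment *)

Theorem proposition4p5 (R : realType) (k : entries) (n1 n2 : nat)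
    (f : 'cV[R]_(minn n1 n2) -> \bar R)
    (f_ge0 : forall x, (0 <= f x)%E)
    (f_lsc : lower_semicontinuous f)
    (f_sym : abs_symmetric f)
    (P : set 'cV[R]_(minn n1 n2))
    (P_inv : signperm_invariant P)
    (X' Z' : 'M[scalarT R k]_(n1, n2))
    (U' : 'M[scalarT R k]_n1) (V' : 'M[scalarT R k]_n2)
    (x' z' : 'cV[R]_(minn n1 n2))
    (x'E : x' = sigma X')
    (X'svd : is_svd X' U' x' V') :
  let F := fun X : 'M[scalarT R k]_(n1, n2) => f (sigma X) in
  let dGF := subdiff (@re_frob R k n1 n2) (Genv (@re_frob R k n1 n2) F) in
  let dGf := subdiff (@dotv R (minn n1 n2)) (Genv (@dotv R (minn n1 n2)) f) in
  let qM := quotient (@re_frob R k n1 n2) X' Z' in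
  let qv := quotient (@dotv R (minn n1 n2)) x' z' in
  let infM :=
    ereal_inf [set ereal_inf [set (qM Y W)%:E | W in dGF Y]
              | Y in [set Y | Y <> X' /\ P (sigma Y)]] in
  let infv :=
    ereal_inf [set ereal_inf [set (qv y w)%:E | w in dGf y]
              | y in [set y | P y /\ y <> x']] in
  dGF X' Z' ->
  z' = sigma Z' ->
  infM = infv /\
  ((exists Y W, [/\ Y <> X', P (sigma Y), dGF Y W & (qM Y W)%:E = infM]) <->
   (exists y w, [/\ P y, y <> x', dGf y w & (qv y w)%:E = infv])).
Proof.
move=> F dGF dGf qM qv infM infv dGFX' z'E.
have fI := abs_symmetric_signed_perm f_sym.
have gI : signed_perm_invariant (Genv (@dotv R (minn n1 n2)) f).
  exact: Genv_signed_perm.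
have dGFE : dGF = subdiff (@re_frob R k n1 n2)
    (fun X => Genv (@dotv R (minn n1 n2)) f (sigma X)).
  by rewrite /dGF /F Genv_sigma.
(* A frame common to [X'] and [Z'], along which vectors will be lifted. *)
have [U [V]] : exists U V, [/\ is_svd X' U x' V, is_svd Z' U z' V & dGf x' z'].
  by move: dGFX'; rewrite dGFE x'E z'E => /subdiff_sigma_svd; apply.
move=> [X'svd2 Z'svd _]; have [hU hV _] := X'svd2.
(* Passing to vectors may lower the quotient, whereas lifting to matrices preserves it; each
   direction yields one inequality between the infima. *)
have to_vector Y W : Y <> X' -> P (sigma Y) -> dGF Y W ->
    exists y w, [/\ P y, y <> x', dGf y w & qv y w <= qM Y W].
  rewrite dGFE => YX PY /(subdiff_sigma_svd gI)[U2 [V2 [Ysvd Wsvd sub]]].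
  have [s [e [yx le]]] := quotient_signed_perm_le X'svd2 Z'svd Ysvd Wsvd YX.
  exists (signed_perm s e (sigma Y)), (signed_perm s e (sigma W)); split=> //.
    exact: signperm_invariant_signed_perm.
  exact: subdiff_signed_perm.
have to_matrix y w : P y -> y <> x' -> dGf y w ->
    exists Y W, [/\ Y <> X', P (sigma Y), dGF Y W & qM Y W = qv y w].
  move=> Py yx sub.
  have svdD v : is_svd (U *m diag_rect k v *m adjoint V) U v V by [].
  exists (U *m diag_rect k y *m adjoint V), (U *m diag_rect k w *m adjoint V).
  split.
  - case: X'svd2 => _ _ -> e; apply: yx; apply: (@diag_rect_inj R k n1 n2).
    move/(congr1 (fun A => adjoint U *m A *m V)): e.
    by rewrite -!mulmxA !unitaryKV // !adjoint_unitary_mul // !mulmx1.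
  - have [s [e ->]] := sigma_svd (svdD y).
    exact: signperm_invariant_signed_perm.
  - by rewrite dGFE; apply: subdiff_sigma (svdD y) (svdD w) sub.
  - exact: quotient_svd X'svd2 Z'svd (svdD y) (svdD w).
have infM_le Y W : Y <> X' -> P (sigma Y) -> dGF Y W -> (infM <= (qM Y W)%:E)%E.
  move=> YX PY sub.
  have le : (ereal_inf [set (qM Y W)%:E | W in dGF Y] <= (qM Y W)%:E)%E.
    by apply: ereal_inf_lbound; exists W.
  by apply: le_trans le; apply: ereal_inf_lbound; exists Y.
have infv_le y w : P y -> y <> x' -> dGf y w -> (infv <= (qv y w)%:E)%E.
  move=> Py yx sub.
  have le : (ereal_inf [set (qv y w)%:E | w in dGf y] <= (qv y w)%:E)%E.
    by apply: ereal_inf_lbound; exists w.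
  by apply: le_trans le; apply: ereal_inf_lbound; exists y.
have infE : infM = infv.
  apply/le_anti/andP; split.
    apply: le_ereal_inf_tmp => _ [y [Py yx] <-];
      apply: le_ereal_inf_tmp => _ [w sub <-].
    have [Y [W [YX PY subM <-]]] := to_matrix y w Py yx sub.
    exact: infM_le.
  apply: le_ereal_inf_tmp => _ [Y [YX PY] <-];
      apply: le_ereal_inf_tmp => _ [W sub <-].
  have [y [w [Py yx subv le]]] := to_vector Y W YX PY sub.
  by apply: (le_trans (infv_le y w Py yx subv)); rewrite lee_fin.
split=> //; split.
(* For a minimizing matrix pair, the vector quotient lies between [infv] and [infM], which are
   equal. *)
- move=> [Y [W [YX PY sub E]]].
  have [y [w [Py yx subv le]]] := to_vector Y W YX PY sub.
  exists y, w; split=> //; apply/le_anti; rewrite infv_le // andbT.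
  by rewrite -infE -E lee_fin.
- move=> [y [w [Py yx sub E]]].
  have [Y [W [YX PY subM qE]]] := to_matrix y w Py yx sub.
  by exists Y, W; split=> //; rewrite qE E infE.
Qed.
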